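(* Let $\mathcal{A}$, $(C,R)$, $\mathcal{Y}$, and $\mathcal{P}=(\mathcal{P}^1,\mathcal{P}^2,\mathcal{P}^3,\mathcal{P}^4)$ be an associated Mealy $(m,n)$-automaton, matched pair of matrices, grid array, and grid rete. The following are equivalent. (i) $\mathcal{A}$ is bireversible. (ii) $(C,R)$ is a cooperative pair. (iii) $C$ is column-Latin, $R$ is row-Latin, and $C\curvearrowleft R$ is column-Latin. (iv) $C$ is column-Latin, $R$ is row-Latin, and $C\curvearrowright R$ is row-Latin. (v) $C$ is column-Latin, $R$ is row-Latin, and $C$ and $R$ are orthogonal. (vi) $\mathcal{Y}$ is a narrow semi-orthogonal array. (vii) $\mathcal{P}$ is a narrow reticulation.
   Context: $m,n$ are positive integers, $[d]=\{1,\dots,d\}$. A Mealy $(m,n)$-automaton is $\mathcal{A}=(Q,X,\pi,\lambda)$ with $Q=\{q_1,\dots,q_m\}$, $X=\{x_1,\dots,x_n\}$ (ordered), $\pi\colon Q\times X\to Q$, $\lambda\colon Q\times X\to X$. Its transition set is $E=\{(q,x,\pi(q,x),\lambda(q,x))\}$. It is bireversible if for all $q\in Q,y\in X$ exactly one element of $E$ has the form $(q,\cdot,\cdot,y)$, for all $x\in X,r\in Q$ exactly one has the form $(\cdot,x,r,\cdot)$, and for all $r\in Q,y\in X$ exactly one has the form $(\cdot,\cdot,r,y)$. The associated matched pair of matrices $(C,R)$ consists of $m\times n$ matrices, $C$ with entries in $[m]$ and $R$ with entries in $[n]$, with $\pi(q_i,x_j)=q_{C(i,j)}$ and $\lambda(q_i,x_j)=x_{R(i,j)}$.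 The associated grid array is $\mathcal{Y}=\{(i,j,C(i,j),R(i,j)):(i,j)\in[m]\times[n]\}$. The associated grid rete is the $4$-tuple of ordered partitions of $\mathcal{Y}$, $\mathcal{P}^s=\{P^s_h\}_h$ with $P^s_h=\{y\in\mathcal{Y}:y_s=h\}$, $h\in[m]$ for $s\in\{1,3\}$, $h\in[n]$ for $s\in\{2,4\}$ (cells may be empty). $C$ is column-Latin if each element of $[m]$ appears exactly once in each column of $C$; an $m\times n$ matrix over $[n]$ is row-Latin if each element of $[n]$ appears exactly once in each row. $C$ and $R$ are orthogonal if each element of $[m]\times[n]$ appears exactly once among the pairs $(C(i,j),R(i,j))$. For $R$ row-Latin, $C\curvearrowleft R$ is the $m\times n$ matrix over $[m]$ determined by $(C\curvearrowleft R)(i,R(i,j))=C(i,j)$ for all $(i,j)$. For $C$ column-Latin, $C\curvearrowright R$ is the $m\times n$ matrix over $[n]$ determined by $(C\curvearrowright R)(C(i,j),j)=R(i,j)$ for all $(i,j)$. $(C,R)$ is a cooperative pair if $C$ is column-Latin, $R$ is row-Latin, $C\curvearrowleft R$ is column-Latin and $C\curvearrowright R$ is row-Latin. A narrow semi-orthogonal array of order $m\times n$ is a set $\mathcal{Y}\subseteq[m]\times[n]\times[m]\times[n]$ with $|\mathcal{Y}|=mn$ such that for each $(s,t)\in\{(1,2),(2,3),(3,4),(4,1)\}$, distinct $y,y'\in\mathcal{Y}$ have $(y_s,y_t)\neq(y'_s,y'_t)$. A narrow reticulation is a set of points with two types of lines (lines being subsets of the points), each type consisting of two families of lines (the same line may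 occur in both families), such that (R-1) two lines of different types meet in exactly one point, and (R-2) each family of lines partitions the set of points. In (vii) the points are the elements of $\mathcal{Y}$, one type has the families $\mathcal{P}^1,\mathcal{P}^3$, and the other has the families $\mathcal{P}^2,\mathcal{P}^4$; every indexed cell (even if empty) counts as a line. *)

(* Defs.v *)
From mathcomp Require Import all_boot matrix.

Set Implicit Arguments.
Unset Strict Implicit.
Unset Printing Implicit Defensive.

(* Throughout, the index set [d] = {1, ..., d} is 'I_d = {0, ..., d - 1}.     *)

(* q_1, ..., q_m and x_1, ..., x_n are given by the enumerations [state_of]   *)
(* and [letter_of].                                                           *)
Record mealy (m n : nat) := Mealy {
  state : finType;
  letter : finType;
  state_of : 'I_m -> state;
  letter_of : 'I_n -> letter;
  state_of_bij : bijective state_of;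
  letter_of_bij : bijective letter_of;
  next : state -> letter -> state;     (* pi *)
  output : state -> letter -> letter   (* lambda *)
}.

(* Coordinates of a quadruple (a, b, c, d) = (((a, b), c), d). *)
Section Coordinates.
Variables A B C D : Type.
Implicit Type y : A * B * C * D.
Definition coord1 y := y.1.1.1.
Definition coord2 y := y.1.1.2.
Definition coord3 y := y.1.2.
Definition coord4 y := y.2.
End Coordinates.

Definition transitions m n (A : mealy m n) :
    {set state A * letter A * state A * letter A} :=
  [set (q, x, next q x, output q x) | q in [set: state A],
                                      x in [set: letter A]].

Definition bireversible m n (A : mealy m n) : Prop :=
  [/\ forall (q : state A) (y : letter A),
        exists! e, [/\ e \in transitions A, coord1 e = q & coord4 e = y],
      forall (x : letter A) (r : state A),
        exists! e, [/\ e \in transitions A, coord2 e = x & coord3 e = r]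
    & forall (r : state A) (y : letter A),
        exists! e, [/\ e \in transitions A, coord3 e = r & coord4 e = y]].

Section MatchedPairs.
Variables m n : nat.
Implicit Types (C : 'M['I_m]_(m, n)) (R : 'M['I_n]_(m, n)).

Definition matched_pair (A : mealy m n) C R : Prop :=
  forall i j,
    next (state_of A i) (letter_of A j) = state_of A (C i j) /\
    output (state_of A i) (letter_of A j) = letter_of A (R i j).

Definition column_latin C : Prop := forall j h, exists! i, C i j = h.

Definition row_latin R : Prop := forall i k, exists! j, R i j = k.

Definition orthogonal_mx C R : Prop :=
  forall hk : 'I_m * 'I_n,
    exists! ij : 'I_m * 'I_n, (C ij.1 ij.2, R ij.1 ij.2) = hk.

(* The entry at (i, k) is C i j for the j with R i j = k; the default is only *)
(* reached when R is not row-Latin (see curvelP).                             *)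
Definition curvel C R : 'M['I_m]_(m, n) :=
  \matrix_(i, k) C i (odflt k [pick j | R i j == k]).

(* The entry at (h, j) is R i j for the i with C i j = h; the default is only *)
(* reached when C is not column-Latin (see curverP).                          *)
Definition curver C R : 'M['I_n]_(m, n) :=
  \matrix_(h, j) R (odflt h [pick i | C i j == h]) j.

Lemma curvelP C R (D : 'M['I_m]_(m, n)) : row_latin R ->
  (forall i j, D i (R i j) = C i j) <-> D = curvel C R.
Proof.
move=> latR; have E i j : curvel C R i (R i j) = C i j.
  rewrite mxE; case: pickP => [j' /eqP Ej' | /(_ j)]; last by rewrite eqxx.
  by have [j0 [_ uniq0]] := latR i (R i j); rewrite /= -(uniq0 j') // (uniq0 j).
split=> [ED | -> //]; apply/matrixP=> i k.
by have [j [<- _]] := latR i k; rewrite ED E.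
Qed.

Lemma curverP C R (D : 'M['I_n]_(m, n)) : column_latin C ->
  (forall i j, D (C i j) j = R i j) <-> D = curver C R.
Proof.
move=> latC; have E i j : curver C R (C i j) j = R i j.
  rewrite mxE; case: pickP => [i' /eqP Ei' | /(_ i)]; last by rewrite eqxx.
  by have [i0 [_ uniq0]] := latC j (C i j); rewrite /= -(uniq0 i') // (uniq0 i).
split=> [ED | -> //]; apply/matrixP=> h j.
by have [i [<- _]] := latC j h; rewrite ED E.
Qed.

Definition cooperative C R : Prop :=
  [/\ column_latin C, row_latin R,
      column_latin (curvel C R) & row_latin (curver C R)].

Definition quad : finType := ('I_m * 'I_n * 'I_m * 'I_n)%type.

Definition grid_array C R : {set quad} :=
  [set (i, j, C i j, R i j) | i in [set: 'I_m], j in [set: 'I_n]].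

Definition separates (S T : Type) (Y : {set quad})
    (s : quad -> S) (t : quad -> T) : Prop :=
  forall y y', y \in Y -> y' \in Y -> y <> y' -> (s y, t y) <> (s y', t y').

Definition narrow_semi_orthogonal_array (Y : {set quad}) : Prop :=
  #|Y| = (m * n)%N /\
  [/\ separates Y (@coord1 _ _ _ _) (@coord2 _ _ _ _),
      separates Y (@coord2 _ _ _ _) (@coord3 _ _ _ _),
      separates Y (@coord3 _ _ _ _) (@coord4 _ _ _ _)
    & separates Y (@coord4 _ _ _ _) (@coord1 _ _ _ _)].

End MatchedPairs.

Definition ordered_family (T : finType) (d : nat) := {ffun 'I_d -> {set T}}.

Definition fibers (T : finType) (d : nat) (Y : {set T}) (f : T -> 'I_d) :
    ordered_family T d :=
  [ffun h => [set y in Y | f y == h]].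

Record rete (T : finType) (m n : nat) := Rete {
  part1 : ordered_family T m;
  part2 : ordered_family T n;
  part3 : ordered_family T m;
  part4 : ordered_family T n
}.

Definition grid_rete m n (Y : {set quad m n}) : rete (quad m n) m n :=
  Rete (fibers Y (@coord1 _ _ _ _)) (fibers Y (@coord2 _ _ _ _))
       (fibers Y (@coord3 _ _ _ _)) (fibers Y (@coord4 _ _ _ _)).

(* finset's [partition] excludes empty blocks; here they are allowed. *)
Definition weak_partition (T : finType) (F : {set {set T}}) (S : {set T}) :
    Prop :=
  cover F = S /\ trivIset F.

(* [S] is the set of points; one type of lines consists of the families [F]   *)
(* and [F'], the other of [G] and [G'].                                       *)
Definition narrow_reticulation (T : finType) (S : {set T})
    (F F' G G' : {set {set T}}) : Prop :=
  (forall L M, L \in F :|: F' -> M \in G :|: G' ->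
     exists! p, p \in L /\ p \in M) /\
  [/\ weak_partition F S, weak_partition F' S,
      weak_partition G S & weak_partition G' S].

(* All the indexed cells, including the empty ones. *)
Definition lines (T : finType) (d : nat) (P : ordered_family T d) :
    {set {set T}} :=
  [set P h | h in [set: 'I_d]].

Definition rete_narrow_reticulation (T : finType) (m n : nat) (S : {set T})
    (P : rete T m n) : Prop :=
  narrow_reticulation S (lines (part1 P)) (lines (part3 P))
                        (lines (part2 P)) (lines (part4 P)).

(* Main.v *)
(* Each condition amounts to the same three statements: C column-Latin, R     *)
(* row-Latin, C and R orthogonal.  These say that the self-maps               *)
(* (i, j) |-> (C i j, j), (i, R i j) and (C i j, R i j) of the finite set     *)
(* [m] x [n] are bijective, equivalently injective: two coordinates of a grid *)
(* quadruple determine it.  Since C curvel R sends (i, R i j) to C i j, its   *)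
(* map (i, k) |-> (_, k) composed with the bijection (i, j) |-> (i, R i j) is *)
(* (i, j) |-> (C i j, R i j), and symmetrically for C curver R.               *)
Require Import Defs.
From mathcomp Require Import all_boot matrix.
From Corelib Require Import Setoid Morphisms.

Set Implicit Arguments.
Unset Strict Implicit.
Unset Printing Implicit Defensive.

(** The grid array is the graph of the map sending a cell (i, j) to (C i j, R i j), so it has mn
    points, as many as there are pairs in [m] x [n]. Hence, for one coordinate valued in [m] and one
    in [n], every pair of values is attained exactly once as soon as it is attained at most once.
    Coordinates (2,3), (4,1) and (3,4) give column-Latin, row-Latin and orthogonal, while (1,2)
    always determines the cell. Thus bireversibility, separation and meeting of lines all become
    joint injectivity: [bireversibleP], [narrow_semi_orthogonal_gridP] and [grid_reticulationP]
    reduce them to (v), with the counting done in [unique_pointP]. The lemmas [column_latin_curvel]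
    and [row_latin_curver] do the same for the two derived matrices by a change of variables. *)

#[local] Instance and3_iff :
  Proper (iff ==> iff ==> iff ==> iff) and3.
Proof. by move=> ? ? E1 ? ? E2 ? ? E3; split=> -[/E1 ? /E2 ? /E3 ?]. Qed.

(** Like [and3_iff], this lets [rewrite] replace a conjunct by an equivalent one. *)
#[local] Instance and4_iff :
  Proper (iff ==> iff ==> iff ==> iff ==> iff) and4.
Proof.
by move=> ? ? E1 ? ? E2 ? ? E3 ? ? E4; split=> -[/E1 ? /E2 ? /E3 ? /E4 ?].
Qed.

Definition jointly_injective (Z S T : Type) (f : Z -> S) (g : Z -> T) :=
  injective (fun z => (f z, g z)).

Lemma jointly_injectiveC (Z S T : Type) (f : Z -> S) (g : Z -> T) :
  jointly_injective f g <-> jointly_injective g f.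
Proof. by split=> inj x y [E1 E2]; apply: inj; rewrite E1 E2. Qed.

Lemma jointly_injective_bij (Z Z' S T : Type) (b : Z -> Z')
    (f : Z' -> S) (g : Z' -> T) : bijective b ->
  jointly_injective (f \o b) (g \o b) <-> jointly_injective f g.
Proof.
move=> bij_b; split=> inj; last by apply: inj_comp inj (bij_inj bij_b).
case: bij_b => b' bK b'K x y [Ef Eg]; apply: (can_inj b'K).
by apply: inj; rewrite /= !b'K Ef Eg.
Qed.

(** Uniqueness is injectivity, and existence follows by counting. The bijections [a] and [b] let one
    statement serve both the transitions, whose coordinates are states and letters, and the grid
    points, whose coordinates are indices. *)
Lemma unique_pointP (I K Z U : finType) (S T : Type) (a : I -> S) (b : K -> T)
    (Y : {set U}) (q : Z -> U) (s : U -> S) (t : U -> T)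
    (f : Z -> I) (g : Z -> K) :
    bijective a -> bijective b -> #|Z| = (#|I| * #|K|)%N ->
    injective q -> (forall p, p \in Y <-> exists z, p = q z) ->
    (forall z, s (q z) = a (f z)) -> (forall z, t (q z) = b (g z)) ->
  (forall h k, exists! p, [/\ p \in Y, s p = h & t p = k])
    <-> jointly_injective f g.
Proof.
move=> bij_a bij_b cardZ inj_q YP sq tq; split=> [uniq | inj].
  move=> x y [Ef Eg]; apply: inj_q.
  have [p [_ eqp]] := uniq (a (f y)) (b (g y)).
  have pE z : f z = f y -> g z = g y -> p = q z.
    move=> Efz Egz; apply: eqp.
    by split; [apply/YP; exists z | rewrite sq Efz | rewrite tq Egz].
  by rewrite -(pE x) // -(pE y).
have bij_fg: bijective (fun z => (f z, g z)).
  by apply: inj_card_bij => //; rewrite card_prod cardZ.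
case: bij_fg => d dK Kd; case: bij_a => a' aK Ka; case: bij_b => b' bK Kb h k.
have [Ef Eg] := Kd (a' h, b' k); exists (q (d (a' h, b' k))); split.
  by split; [apply/YP; eexists | rewrite sq Ef | rewrite tq Eg].
move=> p [/YP[z ->]]; rewrite sq tq => <- <-.
by rewrite aK bK dK.
Qed.

(** Fibers of any function are disjoint and cover, so (R-2) holds for every grid rete. *)
Lemma weak_partition_fibers (T : finType) d (Y : {set T}) (f : T -> 'I_d) :
  weak_partition (lines (fibers Y f)) Y.
Proof.
split; [apply/setP=> y; apply/bigcupP/idP | apply/trivIsetP].
- by case=> _ /imsetP[h _ ->]; rewrite ffunE inE => /andP[].
- move=> Yy; exists (fibers Y f (f y)); first exact: imset_f.
  by rewrite ffunE inE Yy eqxx.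
move=> _ _ /imsetP[h _ ->] /imsetP[k _ ->] neq_hk.
rewrite -setI_eq0; apply/eqP/setP=> y; rewrite !ffunE !inE.
(* A common point forces [h = k], so the two cells are the same set. *)
apply: contraNF neq_hk => /andP[/andP[_ /eqP <-] /andP[_ /eqP <-]].
exact: eqxx.
Qed.

Section MatrixPair.
Variables m n : nat.
Implicit Types (C : 'M['I_m]_(m, n)) (R : 'M['I_n]_(m, n)).

Local Notation cell := ('I_m * 'I_n)%type.

Definition entry (d : nat) (M : 'M['I_d]_(m, n)) (z : cell) := M z.1 z.2.

Lemma card_cell : #|{: cell}| = (m * n)%N.
Proof. by rewrite card_prod !card_ord. Qed.

Lemma column_latinP C :
  column_latin C <-> jointly_injective (entry C) snd.
Proof.
split=> [lat [i j] [i' j'] [/= EC Ej] | inj j h].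
  subst j'; have [i0 [_ uniq]] := lat j (C i' j).
  by rewrite -(uniq i) // -(uniq i').
(* An injective self-map of the finite set of cells has an inverse [d]; the row sought is the first
   component of [d (h, j)]. *)
have [d _ Kd] := injF_bij inj; have [EC Ej] := Kd (h, j).
exists (d (h, j)).1; split=> [|i Ei]; first by rewrite -[in RHS]EC /entry Ej.
have: d (h, j) = (i, j) by apply: inj; rewrite Kd /entry /= Ei.
by move=> ->.
Qed.

Lemma row_latinP R : row_latin R <-> jointly_injective fst (entry R).
Proof.
split=> [lat [i j] [i' j'] [/= Ei ER] | inj i k].
  subst i'; have [j0 [_ uniq]] := lat i (R i j').
  by rewrite -(uniq j) // -(uniq j').
have [d _ Kd] := injF_bij inj; have [Ei ER] := Kd (i, k).
exists (d (i, k)).2; split=> [|j Ej]; first by rewrite -[in RHS]ER /entry Ei.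
have: d (i, k) = (i, j) by apply: inj; rewrite Kd /entry /= Ej.
by move=> ->.
Qed.

Lemma orthogonal_mxP C R :
  orthogonal_mx C R <-> jointly_injective (entry C) (entry R).
Proof.
split=> [orth x y Exy | inj hk].
  have [z [_ uniq]] := orth (entry C y, entry R y).
  by rewrite -(uniq x Exy) -(uniq y).
have [d dK Kd] := injF_bij inj.
by exists (d hk); split=> [|x <-]; [apply: Kd | apply: dK].
Qed.

Lemma column_latin_curvel C R : row_latin R ->
  column_latin (curvel C R) <-> orthogonal_mx C R.
Proof.
move=> latR; rewrite column_latinP orthogonal_mxP.
have /row_latinP/injF_bij bijR := latR.
have curvelE := (curvelP C (curvel C R) latR).2 erefl.
(* Substituting k = R i j turns the entry of [curvel C R] at (i, k) into [C i j]. *)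
rewrite -(jointly_injective_bij _ _ bijR).
by split=> inj x y E; apply: inj; move: E; rewrite /entry /= !curvelE.
Qed.

Lemma row_latin_curver C R : column_latin C ->
  row_latin (curver C R) <-> orthogonal_mx C R.
Proof.
move=> latC; rewrite row_latinP orthogonal_mxP.
have /column_latinP/injF_bij bijC := latC.
have curverE := (curverP R (curver C R) latC).2 erefl.
rewrite -(jointly_injective_bij _ _ bijC).
by split=> inj x y E; apply: inj; move: E; rewrite /entry /= !curverE.
Qed.

Lemma bireversibleP (A : mealy m n) C R : matched_pair A C R ->
  bireversible A <-> [/\ column_latin C, row_latin R & orthogonal_mx C R].
Proof.
move=> matched; rewrite column_latinP row_latinP orthogonal_mxP.
have bij_q := state_of_bij A; have bij_x := letter_of_bij A.
pose t (z : cell) := (state_of A z.1, letter_of A z.2,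
                      state_of A (entry C z), letter_of A (entry R z)).
have inj_t: injective t.
  by move=> [i j] [i' j'] [/(bij_inj bij_q) -> /(bij_inj bij_x) ->].
(* The enumerations are onto, so every transition comes from a cell. *)
have tP e : e \in transitions A <-> exists z, e = t z.
  split=> [/imset2P[q x _ _ ->] | [[i j] ->]].
    case: bij_q => f _ Kf; case: bij_x => g _ Kg.
    have [Eq Ex] := matched (f q) (g x); rewrite !Kf !Kg in Eq Ex.
    by exists (f q, g x); rewrite /t /= Kf Kg Eq Ex.
  by have [Eq Ex] := matched i j; apply/imset2P; exists (state_of A i)
    (letter_of A j); rewrite ?inE // /t /= Eq Ex.
have cardmn: #|{: cell}| = (#|'I_m| * #|'I_n|)%N by rewrite card_prod.
have cardnm: #|{: cell}| = (#|'I_n| * #|'I_m|)%N by rewrite cardmn mulnC.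
rewrite /bireversible.
rewrite (@unique_pointP _ _ _ _ _ _ _ _ _ t _ _ fst (entry R) bij_q bij_x) //.
rewrite (@unique_pointP _ _ _ _ _ _ _ _ _ t _ _ snd (entry C) bij_x bij_q) //.
rewrite (@unique_pointP _ _ _ _ _ _ _ _ _ t _ _ (entry C) (entry R)
          bij_q bij_x) //.
(* Bireversibility lists the row-Latin condition first and reads the column-Latin one with its two
   coordinates exchanged. *)
by rewrite (jointly_injectiveC snd); split=> -[].
Qed.

Section GridArray.
Variables (C : 'M['I_m]_(m, n)) (R : 'M['I_n]_(m, n)).

Definition grid_point (z : cell) : quad m n := (z.1, z.2, entry C z, entry R z).

Lemma grid_point_inj : injective grid_point.
Proof. by move=> [i j] [i' j'] [-> ->]. Qed.

Lemma grid_arrayP p : p \in grid_array C R <-> exists z, p = grid_point z.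
Proof.
split=> [/imset2P[i j _ _ ->] | [[i j] ->]]; first by exists (i, j).
by apply/imset2P; exists i j.
Qed.

Lemma card_grid_array : #|grid_array C R| = (m * n)%N.
Proof.
rewrite -card_cell -(card_codom grid_point_inj); apply: eq_card => p.
by apply/idP/codomP => /grid_arrayP.
Qed.

Lemma separates_gridP (S T : Type) (s : quad m n -> S) (t : quad m n -> T) :
  separates (grid_array C R) s t <->
  forall x y, s (grid_point x) = s (grid_point y) ->
    t (grid_point x) = t (grid_point y) -> x = y.
Proof.
split=> [sep x y Es Et | inj y y' /grid_arrayP[x ->] /grid_arrayP[x' ->]].
  apply/eqP/negP => /negP neq_xy.
  apply: (sep (grid_point x) (grid_point y)).
  - by apply/grid_arrayP; exists x.
  - by apply/grid_arrayP; exists y.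
  - by move/grid_point_inj=> Exy; rewrite Exy eqxx in neq_xy.
  - by rewrite Es Et.
by move=> neq [Es Et]; apply: neq; rewrite (inj x x').
Qed.

Lemma narrow_semi_orthogonal_gridP :
  narrow_semi_orthogonal_array (grid_array C R) <->
  [/\ column_latin C, row_latin R & orthogonal_mx C R].
Proof.
rewrite column_latinP row_latinP orthogonal_mxP.
rewrite /narrow_semi_orthogonal_array !separates_gridP.
split=> [[_ [_ sepC sepO sepR]] | [injC injR injO]].
  split=> x y [E1 E2]; [exact: sepC | exact: sepR | exact: sepO].
split; first exact: card_grid_array.
split=> x y; rewrite /coord1 /coord2 /coord3 /coord4 /= => E1 E2.
- by rewrite (surjective_pairing x) E1 E2 -surjective_pairing.
- by apply: injC; rewrite E1 E2.
- by apply: injO; rewrite E1 E2.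
- by apply: injR; rewrite E1 E2.
Qed.

Lemma meet_gridP (s : quad m n -> 'I_m) (t : quad m n -> 'I_n) :
  (forall L M, L \in lines (fibers (grid_array C R) s) ->
     M \in lines (fibers (grid_array C R) t) -> exists! p, p \in L /\ p \in M)
  <-> jointly_injective (s \o grid_point) (t \o grid_point).
Proof.
have cardmn: #|{: cell}| = (#|'I_m| * #|'I_n|)%N by rewrite card_prod.
(* Coordinates of grid points are already indices, so both enumerations are the identity, bijective
   as an involution. *)
rewrite -(@unique_pointP _ _ _ _ _ _ id id (grid_array C R) grid_point s t _ _
  (inv_bij (fun=> erefl)) (inv_bij (fun=> erefl)) cardmn grid_point_inj
  grid_arrayP) //.
have cellP h k p : [/\ p \in grid_array C R, s p = h & t p = k] <->
    p \in fibers (grid_array C R) s h /\ p \in fibers (grid_array C R) t k.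
  rewrite !ffunE !inE; split=> [[-> -> ->] | [/andP[-> /eqP->] /eqP->]] //.
  by rewrite !eqxx.
split=> [meet h k | uniq _ _ /imsetP[h _ ->] /imsetP[k _ ->]].
  have [||p [/cellP pP uniq]] := meet (fibers (grid_array C R) s h)
    (fibers (grid_array C R) t k); try exact: imset_f.
  by exists p; split=> // p' /cellP /uniq.
have [p [/cellP pP eqp]] := uniq h k.
by exists p; split=> // p' /cellP /eqp.
Qed.

Lemma grid_reticulationP :
  rete_narrow_reticulation (grid_array C R) (grid_rete (grid_array C R)) <->
  [/\ column_latin C, row_latin R & orthogonal_mx C R].
Proof.
rewrite column_latinP row_latinP orthogonal_mxP.
split=> [[meet _] | [injC injR injO]].
  by split; [apply/(meet_gridP (@coord3 _ _ _ _) (@coord2 _ _ _ _))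
           | apply/(meet_gridP (@coord1 _ _ _ _) (@coord4 _ _ _ _))
           | apply/(meet_gridP (@coord3 _ _ _ _) (@coord4 _ _ _ _))];
     move=> L M LP MP; apply: meet; rewrite inE /= ?LP ?MP ?orbT.
split; last by split; exact: weak_partition_fibers.
move=> L M /setUP[] LP /setUP[] MP; move: L M LP MP; apply/meet_gridP=> //.
(* What remains is the pair of coordinates (1,2), which is the cell itself. *)
by move=> [i j] [i' j'].
Qed.

End GridArray.

End MatrixPair.

Theorem theorem5p15 (m n : nat) (m_gt0 : 0 < m) (n_gt0 : 0 < n)
    (A : mealy m n) (C : 'M['I_m]_(m, n)) (R : 'M['I_n]_(m, n))
    (Y : {set quad m n}) (P : rete (quad m n) m n)
    (matchedCR : matched_pair A C R)
    (gridY : Y = grid_array C R)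
    (reteP : P = grid_rete Y) :
  [<-> bireversible A;
       cooperative C R;
       [/\ column_latin C, row_latin R & column_latin (curvel C R)];
       [/\ column_latin C, row_latin R & row_latin (curver C R)];
       [/\ column_latin C, row_latin R & orthogonal_mx C R];
       narrow_semi_orthogonal_array Y;
       rete_narrow_reticulation Y P].
Proof.
subst P Y; tfae.
- case/(bireversibleP matchedCR)=> latC latR orth.
  by split=> //; [apply/column_latin_curvel | apply/row_latin_curver].
- by case.
- case=> latC latR /(column_latin_curvel _ latR) orth.
  by split=> //; apply/row_latin_curver.
- by case=> latC latR /(row_latin_curver _ latC).
- by move/narrow_semi_orthogonal_gridP.
- by move/narrow_semi_orthogonal_gridP/grid_reticulationP.
- by move/grid_reticulationP/(bireversibleP matchedCR).
Qed.
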